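(* Let $\varphi_{Ne}(z):=1+z-z^3/3$, and let $p(z)+\beta zp'(z)\prec1+z$, where $p\in\mathcal{H}$ satisfies $p(0)=1$ and $\beta>0$. Then $p\prec\varphi_{Ne}$ for $\beta\geq1/2$. The estimate on $\beta$ is sharp.
   Context: $\mathbb{D}=\{z\in\mathbb{C}:|z|<1\}$ and $\mathcal{H}$ is the set of all analytic functions on $\mathbb{D}$. For $f,g\in\mathcal{H}$, $f\prec g$ ($f$ is subordinate to $g$) means that there is $w\in\mathcal{H}$ with $w(0)=0$ and $|w(z)|<1$ for $z\in\mathbb{D}$ such that $f(z)=g(w(z))$ on $\mathbb{D}$. That the estimate $\beta\ge1/2$ is sharp means that $1/2$ cannot be replaced by any smaller positive number so that the implication remains valid for all such $p$ and all $\beta$ at least that number. *)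

(* Defs.v *)
From Stdlib Require Import Reals.
From Coquelicot Require Import Coquelicot.

Open Scope R_scope.

(* Functions on the unit disc are total functions [C -> C] of which only the
   values at points with [Cmod z < 1] are ever used. *)
Definition in_disc (z : C) : Prop := Cmod z < 1.

(* [ex_derive] is taken over [C_AbsRing], hence is complex differentiability. *)
Definition analytic_on_disc (f : C -> C) : Prop :=
  forall z : C, in_disc z -> @ex_derive C_AbsRing C_NormedModule f z.

Definition subordinate (f g : C -> C) : Prop :=
  exists w : C -> C,
    analytic_on_disc w /\
    w (RtoC 0) = RtoC 0 /\
    (forall z : C, in_disc z -> Cmod (w z) < 1) /\
    (forall z : C, in_disc z -> f z = g (w z)).

Definition phi_Ne (z : C) : C := (1 + z - z ^ 3 / 3)%C.

(* Main.v *)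
Require Import Defs.
From Stdlib Require Import Reals Lra Lia IndefiniteDescription.
From Coquelicot Require Import Coquelicot.

(** Put [q = p - 1], so that [q + beta z q' = w] with [|w| < 1] and [q 0 = 0].
    The quotient [u = q / z] satisfies [(1 + beta) u + beta z u' = w / z].  By the
    maximum principle [Re (c u)] is largest over [|z| <= r] at a point of [|z| = r], where
    its radial derivative [Re (c z u')] is nonnegative, hence [(1 + beta) |u| <= 1 / r]; letting [r -> 1],
    [|q z| <= |z| / (1 + beta) <= 2/3 |z|].  No Cauchy theory is needed for this
    maximum principle: the equation exhibits [z u'] as a combination of [w / z] and [q / z], so
    [u] is twice differentiable off [0], and in logarithmic coordinates
    [z = z1 e^(t + i th)] the function [Re (c u) + delta (t + e^t)] has Laplacian
    [delta e^t > 0]; the term [delta t] keeps the maximum away from the singularity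
    [z = 0].
    By Banach iteration [x - x^3/3 = v] has a solution in the unit disc, depending
    holomorphically on [v], as soon as [|v| < 2/3], which gives the subordination.
    Sharpness: for [p = 1 + z / (1 + beta)] the values on the positive axis
    exceed [1 + 2/3] when [beta < 1/2], while [phi_Ne] takes no real value
    [>= 1 + 2/3] in the disc. *)

(** * Complex differentiability in epsilon-delta form *)

(** Equivalent to [is_derive] over [C] (next lemma).  Coquelicot has two different
    uniform structures on [C], from [Cmod] and from the product [R * R]; this form
    avoids both. *)
Definition has_cderiv (f : C -> C) (z l : C) : Prop :=
  forall eps : R, 0 < eps -> exists d : R, 0 < d /\
    forall y : C, Cmod (y - z) < d ->
      Cmod (f y - f z - (y - z) * l) <= eps * Cmod (y - z).

Lemma is_derive_has_cderiv (f : C -> C) (z l : C) :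
  @is_derive C_AbsRing C_NormedModule f z l <-> has_cderiv f z l.
Proof.
  split.
  - intros [_ H] eps Heps.
    specialize (H z (fun P HP => HP) (mkposreal eps Heps)).
    destruct H as [d Hd].
    exists d. split; [apply cond_pos|].
    intros y Hy. exact (Hd y Hy).
  - intros H. split; [apply is_linear_scal_l|].
    intros x Hx eps.
    (* [is_derive] quantifies over all limits of the neighbourhood filter of [z]; by separation [z]
       is the only one. *)
    assert (x = z) as ->.
    { symmetry. exact (@is_filter_lim_locally_unique C_AbsRing (AbsRing_NormedModule C_AbsRing) z x Hx). }
    destruct (H eps (cond_pos eps)) as [d [Hd0 Hd]].
    exists (mkposreal d Hd0). intros y Hy. exact (Hd y Hy).
Qed.

Lemma has_cderiv_linear (f g : C -> C) (a b z lf lg : C) :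
  has_cderiv f z lf -> has_cderiv g z lg ->
  has_cderiv (fun y => a * f y + b * g y)%C z (a * lf + b * lg)%C.
Proof.
  intros Hf Hg eps Heps.
  set (K := Cmod a + Cmod b + 1).
  assert (Ha := Cmod_ge_0 a). assert (Hb := Cmod_ge_0 b).
  assert (HK : 0 < K) by (unfold K; lra).
  destruct (Hf (eps / K)) as [d1 [Hd1 H1]]; [now apply Rdiv_lt_0_compat|].
  destruct (Hg (eps / K)) as [d2 [Hd2 H2]]; [now apply Rdiv_lt_0_compat|].
  exists (Rmin d1 d2). split; [now apply Rmin_pos|].
  intros y Hy.
  specialize (H1 y (Rlt_le_trans _ _ _ Hy (Rmin_l _ _))).
  specialize (H2 y (Rlt_le_trans _ _ _ Hy (Rmin_r _ _))).
  replace (a * f y + b * g y - (a * f z + b * g z) - (y - z) * (a * lf + b * lg))%C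
    with (a * (f y - f z - (y - z) * lf) + b * (g y - g z - (y - z) * lg))%C by ring.
  eapply Rle_trans; [apply Cmod_triangle|]. rewrite !Cmod_mult.
  assert (Hm := Cmod_ge_0 (y - z)).
  assert (Hq : 0 <= eps / K * Cmod (y - z)).
  { apply Rmult_le_pos; [|easy]. left. now apply Rdiv_lt_0_compat. }
  replace (eps * Cmod (y - z)) with (K * (eps / K * Cmod (y - z))) by (field; lra).
  unfold K at 1.
  assert (Cmod a * Cmod (f y - f z - (y - z) * lf) <= Cmod a * (eps / K * Cmod (y - z)))
    by now apply Rmult_le_compat_l.
  assert (Cmod b * Cmod (g y - g z - (y - z) * lg) <= Cmod b * (eps / K * Cmod (y - z)))
    by now apply Rmult_le_compat_l.
  lra.
Qed.

Lemma has_cderiv_continuous (f : C -> C) (z l : C) :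
  has_cderiv f z l ->
  forall eps : R, 0 < eps -> exists d : R, 0 < d /\
    forall y : C, Cmod (y - z) < d -> Cmod (f y - f z) < eps.
Proof.
  intros H eps Heps.
  destruct (H 1 Rlt_0_1) as [d [Hd H1]].
  assert (Hl := Cmod_ge_0 l).
  assert (He : 0 < eps / (Cmod l + 1)) by (apply Rdiv_lt_0_compat; lra).
  exists (Rmin d (eps / (Cmod l + 1))). split; [now apply Rmin_pos|].
  intros y Hy.
  specialize (H1 y (Rlt_le_trans _ _ _ Hy (Rmin_l _ _))).
  assert (H2 := Rlt_le_trans _ _ _ Hy (Rmin_r _ _)).
  replace (f y - f z)%C with ((f y - f z - (y - z) * l) + (y - z) * l)%C by ring.
  eapply Rle_lt_trans; [apply Cmod_triangle|]. rewrite Cmod_mult.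
  apply Rmult_lt_compat_r with (r := Cmod l + 1) in H2; [|lra].
  replace (eps / (Cmod l + 1) * (Cmod l + 1)) with eps in H2 by (field; lra).
  lra.
Qed.

Lemma Cmod_triangle_inv (a b : C) : Cmod a - Cmod b <= Cmod (a - b).
Proof.
  assert (H := Cmod_triangle (a - b) b).
  replace (a - b + b)%C with a in H by ring. lra.
Qed.

Lemma Cminus_swap_mod (a b : C) : Cmod (a - b) = Cmod (b - a).
Proof. rewrite <- Cmod_opp. f_equal. ring. Qed.

(** The outer division by [z] is kept because [z u'] is the quantity needed for [u = q / z]: it is
    the numerator [l - f z / z]. *)
Lemma has_cderiv_div_id (f : C -> C) (z l : C) :
  z <> RtoC 0 -> has_cderiv f z l ->
  has_cderiv (fun y => f y / y)%C z ((l - f z / z) / z)%C.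
Proof.
  intros Hz H eps Heps.
  assert (Hz0 := proj1 (Cmod_gt_0 z) Hz).
  set (m := (l - f z / z)%C). assert (Hm := Cmod_ge_0 m).
  set (e1 := eps * Cmod z / 4).
  assert (He1 : 0 < e1) by (unfold e1; apply Rdiv_lt_0_compat; [apply Rmult_lt_0_compat|]; lra).
  destruct (H e1 He1) as [d [Hd H1]].
  set (d2 := eps * Cmod z * Cmod z / (4 * (Cmod m + 1))).
  assert (Hd2 : 0 < d2).
  { unfold d2. apply Rdiv_lt_0_compat; [|lra]. repeat apply Rmult_lt_0_compat; lra. }
  exists (Rmin (Cmod z / 2) (Rmin d d2)). split.
  { repeat apply Rmin_pos; lra. }
  intros y Hy.
  assert (Hy1 := Rlt_le_trans _ _ _ Hy (Rmin_l _ _)).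
  assert (Hy2 := Rlt_le_trans _ _ _ (Rlt_le_trans _ _ _ Hy (Rmin_r _ _)) (Rmin_l _ _)).
  assert (Hy3 := Rlt_le_trans _ _ _ (Rlt_le_trans _ _ _ Hy (Rmin_r _ _)) (Rmin_r _ _)).
  specialize (H1 y Hy2).
  assert (Hya : Cmod z / 2 <= Cmod y).
  { assert (T := Cmod_triangle_inv z y). rewrite Cminus_swap_mod in T. lra. }
  assert (Hy0 : y <> RtoC 0) by (apply Cmod_gt_0; lra).
  (* The remainder of [f] over [y], made small by [e1], plus a term quadratic in [y - z], made small
     by [d2]; both bounds use [Cmod z / 2 <= Cmod y]. *)
  replace (f y / y - f z / z - (y - z) * (m / z))%C with
    ((f y - f z - (y - z) * l) / y + - ((y - z) * (y - z) * m / (y * z)))%C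
    by (unfold m; field; split; assumption).
  eapply Rle_trans; [apply Cmod_triangle|].
  rewrite Cmod_opp, !Cmod_div, !Cmod_mult by (try apply Cmult_neq_0; assumption).
  set (h := Cmod (y - z)) in *. assert (Hh : 0 <= h) by apply Cmod_ge_0.
  assert (A1 : Cmod (f y - f z - (y - z) * l) / Cmod y <= eps / 2 * h).
  { apply Rle_div_l; [lra|]. eapply Rle_trans; [exact H1|]. unfold e1.
    replace (eps * Cmod z / 4 * h) with (eps / 2 * h * (Cmod z / 2)) by field.
    apply Rmult_le_compat_l; [|lra]. apply Rmult_le_pos; lra. }
  assert (A2 : h * h * Cmod m / (Cmod y * Cmod z) <= eps / 2 * h).
  { apply Rle_div_l; [apply Rmult_lt_0_compat; lra|].
    assert (B : h * (Cmod m + 1) <= eps * Cmod z * Cmod z / 4).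
    { apply Rlt_le. apply Rmult_lt_compat_r with (r := Cmod m + 1) in Hy3; [|lra].
      replace (d2 * (Cmod m + 1)) with (eps * Cmod z * Cmod z / 4) in Hy3
        by (unfold d2; field; lra). exact Hy3. }
    assert (B2 : h * Cmod m <= eps / 2 * (Cmod y * Cmod z)).
    { assert (eps * Cmod z * (Cmod z / 2) <= eps * Cmod z * Cmod y).
      { apply Rmult_le_compat_l; [apply Rmult_le_pos|]; lra. }
      nra. }
    apply Rmult_le_compat_l with (r := h) in B2; [|lra]. lra. }
  lra.
Qed.

(** Subtracting the linear part of [f] leaves a remainder with derivative 0 at [t], because the path
    is Lipschitz at [t]; the rest is real-affine in [x] and [y]. *)
Lemma has_cderiv_comp_path (f : C -> C) (x y : R -> R) (t a b : R) (c l : C) :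
  has_cderiv f (x t, y t) l -> is_derive x t a -> is_derive y t b ->
  is_derive (fun s => Re (c * f (x s, y s))) t (Re (c * (l * (a, b)))).
Proof.
  intros Hf Hx Hy.
  set (g := fun s => (x s, y s) : C).
  (* [rho] is the first-order remainder of [f] along the path. *)
  set (rho := fun s => Re (c * (f (g s) - f (g t) - (g s - g t) * l))%C).
  assert (Hrho : is_derive rho t 0).
  { apply is_derive_Reals. intros eps Heps.
    apply is_derive_Reals in Hx. apply is_derive_Reals in Hy.
    destruct (Hx 1 Rlt_0_1) as [d1 H1]. destruct (Hy 1 Rlt_0_1) as [d2 H2].
    (* A Lipschitz constant of the path at [t]: a difference quotient within 1 of [a] is at most
       [Rabs a + 1] in absolute value, and likewise for [b]. *)
    set (K := Rabs a + Rabs b + 2).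
    assert (Ha := Rabs_pos a). assert (Hb := Rabs_pos b).
    assert (HK : 0 < K) by (unfold K; lra).
    assert (Hc := Cmod_ge_0 c).
    assert (HE : 0 < eps / (2 * (Cmod c + 1) * K)).
    { apply Rdiv_lt_0_compat; [lra|]. apply Rmult_lt_0_compat; lra. }
    destruct (Hf _ HE) as [d3 [Hd3 H3]].
    assert (Hdd : 0 < Rmin (Rmin d1 d2) (d3 / K)).
    { repeat apply Rmin_pos; try apply cond_pos. now apply Rdiv_lt_0_compat. }
    exists (mkposreal _ Hdd). intros h Hh0 Hh. simpl in Hh.
    assert (Hh1 : Rabs h < d1).
    { eapply Rlt_le_trans; [exact Hh|]. eapply Rle_trans; [apply Rmin_l|apply Rmin_l]. }
    assert (Hh2 : Rabs h < d2).
    { eapply Rlt_le_trans; [exact Hh|]. eapply Rle_trans; [apply Rmin_l|apply Rmin_r]. }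
    assert (Hh3 : Rabs h < d3 / K).
    { eapply Rlt_le_trans; [exact Hh|]. apply Rmin_r. }
    specialize (H1 h Hh0 Hh1). specialize (H2 h Hh0 Hh2).
    assert (Hhp := Rabs_pos_lt h Hh0).
    assert (lip : forall (z : R -> R) (e : R), Rabs ((z (t + h) - z t) / h - e) < 1 ->
              Rabs (z (t + h) - z t) <= (Rabs e + 1) * Rabs h).
    { intros z e He.
      assert (Rabs ((z (t + h) - z t) / h) <= Rabs e + 1).
      { assert (T := Rabs_triang_inv ((z (t + h) - z t) / h) e). lra. }
      unfold Rdiv in H. rewrite Rabs_mult, Rabs_inv in H.
      apply Rmult_le_compat_r with (r := Rabs h) in H; [|lra].
      rewrite Rmult_assoc, Rinv_l, Rmult_1_r in H by lra. exact H. }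
    apply lip in H1. apply lip in H2.
    assert (Hg : Cmod (g (t + h)%R - g t) <= K * Rabs h).
    { replace (g (t + h)%R - g t)%C
        with (RtoC (x (t + h)%R - x t)%R + RtoC (y (t + h) - y t)%R * Ci)%C
        by (unfold g; apply injective_projections; simpl; ring).
      eapply Rle_trans; [apply Cmod_triangle|].
      rewrite Cmod_mult, Cmod_Ci, !Cmod_R. unfold K. lra. }
    assert (Hg3 : Cmod (g (t + h)%R - g t) < d3).
    { eapply Rle_lt_trans; [exact Hg|].
      apply Rmult_lt_compat_l with (r := K) in Hh3; [|lra].
      replace (K * (d3 / K)) with d3 in Hh3 by (field; lra). exact Hh3. }
    specialize (H3 (g (t + h)) Hg3). fold (g t) in H3.
    assert (E0 : rho t = 0) by (unfold rho; simpl; ring).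
    rewrite E0, !Rminus_0_r.
    unfold Rdiv at 1. rewrite Rabs_mult, Rabs_inv.
    apply Rlt_div_l; [lra|].
    eapply Rle_lt_trans; [apply re_le_Cmod|]. rewrite Cmod_mult.
    apply Rle_lt_trans with (Cmod c * (eps / (2 * (Cmod c + 1) * K) * (K * Rabs h))).
    { apply Rmult_le_compat_l; [lra|].
      eapply Rle_trans; [exact H3|]. apply Rmult_le_compat_l; lra. }
    replace (Cmod c * (eps / (2 * (Cmod c + 1) * K) * (K * Rabs h)))
      with (eps * Rabs h * (Cmod c / (2 * (Cmod c + 1)))) by (field; lra).
    rewrite <- (Rmult_1_r (eps * Rabs h)) at 2.
    apply Rmult_lt_compat_l; [apply Rmult_lt_0_compat; lra|].
    apply Rlt_div_l; lra. }
  apply is_derive_ext with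
    (fun s => rho s + (Re (c * f (g t)) + (Re (c * l) * (x s - x t) - Im (c * l) * (y s - y t)))).
  { intros s. unfold rho, g. simpl. ring. }
  generalize (Re (c * f (g t))); intros k0.
  replace (Re (c * (l * (a, b)))) with (0 + (Re (c * l) * a - Im (c * l) * b))
    by (simpl; ring).
  rewrite <- (is_derive_unique _ _ _ Hx), <- (is_derive_unique _ _ _ Hy),
    <- (is_derive_unique _ _ _ Hrho).
  generalize (Re (c * l)) (Im (c * l)); clearbody rho; intros r1 r2.
  auto_derive.
  - repeat split; eexists; eassumption.
  - change (fun s : R => rho s) with rho. change (fun s : R => x s) with x. change (fun s : R => y s) with y. ring.
Qed.

(** * Extrema of real functions *)

(** If [l > 0], then [G'], which vanishes at [t0], is positive just to its right, and the mean value
    theorem gives a value of [G] above the maximum. *)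
Lemma second_derivative_test (G G' : R -> R) (t0 l eta : R) :
  0 < eta ->
  (forall t, Rabs (t - t0) < eta -> is_derive G t (G' t)) ->
  is_derive G' t0 l ->
  (forall t, Rabs (t - t0) < eta -> G t <= G t0) ->
  l <= 0.
Proof.
  intros Heta HG HG' Hmax.
  destruct (Rle_lt_dec l 0) as [|Hl]; [easy|exfalso].
  assert (Z : G' t0 = 0).
  { assert (D : is_derive G t0 (G' t0)).
    { apply HG. rewrite Rminus_eq_0, Rabs_R0. exact Heta. }
    assert (pr : derivable_pt G t0) by (exists (G' t0); now apply is_derive_Reals).
    rewrite <- (is_derive_unique _ _ _ D), <- (Derive_Reals _ _ pr).
    apply (deriv_maximum G (t0 - eta) (t0 + eta)); [lra|lra|].
    intros x H1 H2. apply Hmax. apply Rabs_def1; lra. }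
  apply is_derive_Reals in HG'.
  destruct (HG' l Hl) as [d Hd]. assert (Hd0 := cond_pos d).
  set (s := Rmin d eta / 2).
  assert (Hs : 0 < s < d /\ s < eta).
  { unfold s. assert (T1 := Rmin_l d eta). assert (T2 := Rmin_r d eta).
    assert (T3 := Rmin_pos d eta Hd0 Heta). lra. }
  destruct (MVT_cor2 G G' t0 (t0 + s)) as [c [Hc1 Hc2]]; [lra| |].
  { intros c Hc. apply is_derive_Reals, HG. apply Rabs_def1; lra. }
  assert (Hle : G (t0 + s) <= G t0) by (apply Hmax; apply Rabs_def1; lra).
  assert (P : Rabs ((G' (t0 + (c - t0)) - G' t0) / (c - t0) - l) < l).
  { apply Hd; [lra|]. apply Rabs_def1; lra. }
  replace (t0 + (c - t0)) with c in P by ring. rewrite Z, Rminus_0_r in P.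
  apply Rabs_def2 in P. destruct P as [_ P].
  assert (P' : 0 < G' c).
  { replace (G' c) with (G' c / (c - t0) * (c - t0)) by (field; lra).
    apply Rmult_lt_0_compat; lra. }
  assert (0 < G' c * (t0 + s - t0)) by (apply Rmult_lt_0_compat; lra). lra.
Qed.

(** Maximize in [y] for each [x], choose a maximizer [Y x], then maximize in [x]: uniform continuity
    makes the partial maximum continuous in [x]. *)
Lemma rectangle_max (f : R -> R -> R) (a b c d : R) :
  a <= b -> c <= d ->
  (forall x y, a <= x <= b -> c <= y <= d -> continuity_2d_pt f x y) ->
  exists x0 y0, a <= x0 <= b /\ c <= y0 <= d /\
    forall x y, a <= x <= b -> c <= y <= d -> f x y <= f x0 y0.
Proof.
  intros Hab Hcd Hf.
  assert (U := uniform_continuity_2d f a b c d Hf).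
  (* Clamping to the interval extends the partial maximum to the whole line, so that it is
     continuous from both sides at the end points too. *)
  set (cl := fun x => Rmax a (Rmin x b)).
  assert (Hcl : forall x, a <= cl x <= b).
  { intros x. unfold cl. split; [apply Rmax_l|]. apply Rmax_lub; [easy|apply Rmin_r]. }
  assert (Hid : forall x, a <= x <= b -> cl x = x).
  { intros x Hx. unfold cl. rewrite Rmin_left, Rmax_right; lra. }
  destruct (functional_choice (fun x y => c <= y <= d /\ forall y', c <= y' <= d -> f (cl x) y' <= f (cl x) y))
    as [Y HY].
  { intros x.
    destruct (continuity_ab_maj (f (cl x)) c d Hcd) as [y [H1 H2]].
    - intros y Hy eps Heps.
      destruct (Hf (cl x) y (Hcl x) Hy (mkposreal eps Heps)) as [e He].
      exists e. split; [apply cond_pos|]. intros y' [_ Hy'].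
      apply He; [rewrite Rminus_eq_0, Rabs_R0; apply cond_pos|exact Hy'].
    - exists y. now split. }
  destruct (continuity_ab_maj (fun x => f (cl x) (Y x)) a b Hab) as [x0 [H1 H2]].
  - intros x Hx eps Heps.
    destruct (U (mkposreal eps Heps)) as [e He]. simpl in He.
    exists e. split; [apply cond_pos|]. intros x' [_ Hx'].
    assert (Hcc : Rabs (cl x' - cl x) < e).
    { eapply Rle_lt_trans; [|exact Hx']. simpl. unfold R_dist, cl, Rmax, Rmin.
      repeat destruct Rle_dec; unfold Rabs; repeat destruct Rcase_abs; lra. }
    assert (Hcc' : Rabs (cl x - cl x') < e) by (rewrite Rabs_minus_sym; exact Hcc).
    assert (Hyy : forall y, Rabs (y - y) < e)
      by (intros y; rewrite Rminus_eq_0, Rabs_R0; apply cond_pos).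
    destruct (HY x) as [I1 J1]. destruct (HY x') as [I2 J2].
    (* Each partial maximum is at least the value at the maximizer of the other, so the two differ
       by less than [eps]. *)
    assert (A1 := He _ _ _ _ (Hcl x) I1 (Hcl x') I1 Hcc (Hyy _)).
    assert (A2 := He _ _ _ _ (Hcl x') I2 (Hcl x) I2 Hcc' (Hyy _)).
    specialize (J1 _ I2). specialize (J2 _ I1).
    apply Rabs_def2 in A1. apply Rabs_def2 in A2.
    simpl. unfold R_dist. apply Rabs_def1; lra.
  - exists (cl x0), (Y x0). split; [apply Hcl|]. split; [apply HY|].
    intros x y Hx Hy.
    assert (J := proj2 (HY x) y Hy). specialize (H1 x Hx). simpl in H1.
    replace (f x y) with (f (cl x) y) by now rewrite Hid.
    lra.
Qed.

Lemma RtoC_neq_0 (a : R) : a <> 0 -> RtoC a <> RtoC 0.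
Proof. intros H E. now apply H, RtoC_inj. Qed.

(** Serves for a maximum at the outer end of a radial segment, where only difference quotients from
    the left are controlled. *)
Lemma left_max_derivative (G : R -> R) (t0 l eta : R) :
  0 < eta -> is_derive G t0 l ->
  (forall t, t0 - eta < t < t0 -> G t <= G t0) ->
  0 <= l.
Proof.
  intros Heta HG Hmax.
  destruct (Rle_lt_dec 0 l) as [|Hl]; [easy|exfalso].
  apply is_derive_Reals in HG.
  destruct (HG (- l)) as [d Hd]; [lra|]. assert (Hd0 := cond_pos d).
  set (s := Rmin d eta / 2).
  assert (Hs : 0 < s < d /\ s < eta).
  { unfold s. assert (T1 := Rmin_l d eta). assert (T2 := Rmin_r d eta).
    assert (T3 := Rmin_pos d eta Hd0 Heta). lra. }
  assert (P : Rabs ((G (t0 + - s) - G t0) / - s - l) < - l).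
  { apply Hd; [lra|]. apply Rabs_def1; lra. }
  apply Rabs_def2 in P.
  assert (M : G (t0 + - s) <= G t0) by (apply Hmax; lra).
  assert (0 <= (G (t0 + - s) - G t0) / - s); [|lra].
  replace ((G (t0 + - s) - G t0) / - s) with ((G t0 - G (t0 + - s)) / s) by (field; lra).
  apply Rdiv_le_0_compat; lra.
Qed.

(** * Logarithmic coordinates and the maximum principle *)

(** This is [z e^(t + i th)], put in real coordinates so that its partial derivatives come from real
    calculus. *)
Definition polar (z : C) (t th : R) : C :=
  (exp t * (fst z * cos th - snd z * sin th), exp t * (fst z * sin th + snd z * cos th)).

Lemma polar_eq (z : C) (t th : R) : polar z t th = (z * (RtoC (exp t) * (cos th, sin th)))%C.
Proof. unfold polar. apply injective_projections; simpl; ring. Qed.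

Lemma Cmod_polar (z : C) (t th : R) : Cmod (polar z t th) = Cmod z * exp t.
Proof.
  rewrite polar_eq, !Cmod_mult, Cmod_R, (Rabs_pos_eq (exp t)) by (left; apply exp_pos).
  replace (Cmod (cos th, sin th)) with 1; [ring|].
  unfold Cmod. simpl fst. simpl snd. rewrite <- !Rsqr_pow2, (Rplus_comm (Rsqr _)), sin2_cos2. now rewrite sqrt_1.
Qed.

Lemma polar_neq_0 (z : C) (t th : R) : z <> RtoC 0 -> polar z t th <> RtoC 0.
Proof.
  intros Hz. apply Cmod_gt_0. rewrite Cmod_polar.
  apply Rmult_lt_0_compat; [now apply Cmod_gt_0|apply exp_pos].
Qed.

Lemma polar_0 (z : C) : polar z 0 0 = z.
Proof. unfold polar. rewrite exp_0, cos_0, sin_0. apply injective_projections; simpl; ring. Qed.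

(** In these coordinates the derivative in [t] is [z d/dz]; the derivative of [f] is written as a
    quotient so that [l] stands for [z f']. *)
Lemma polar_derive_radial (f : C -> C) (z c l : C) (t th : R) :
  polar z t th <> RtoC 0 -> has_cderiv f (polar z t th) (l / polar z t th)%C ->
  is_derive (fun s => Re (c * f (polar z s th))) t (Re (c * l)).
Proof.
  intros Hz Hf.
  replace (c * l)%C with (c * (l / polar z t th * polar z t th))%C by (field; exact Hz).
  refine (has_cderiv_comp_path f (fun s => fst (polar z s th)) (fun s => snd (polar z s th)) t
    (fst (polar z t th)) (snd (polar z t th)) c _ Hf _ _);
    unfold polar; simpl; auto_derive; trivial; ring.
Qed.

(** The derivative in [th] is [i z d/dz]; applied twice it gives the opposite of the second radial
    derivative, which is harmonicity. *)
Lemma polar_derive_angular (f : C -> C) (z c l : C) (t th : R) :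
  polar z t th <> RtoC 0 -> has_cderiv f (polar z t th) (l / polar z t th)%C ->
  is_derive (fun s => Re (c * f (polar z t s))) th (Re (c * Ci * l)).
Proof.
  intros Hz Hf.
  replace (c * Ci * l)%C with (c * (l / polar z t th * ((- snd (polar z t th))%R, fst (polar z t th))))%C.
  2: { replace ((- snd (polar z t th))%R, fst (polar z t th)) with (Ci * polar z t th)%C
         by (apply injective_projections; simpl; ring).
       field. exact Hz. }
  refine (has_cderiv_comp_path f (fun s => fst (polar z t s)) (fun s => snd (polar z t s)) th
    _ _ c _ Hf _ _);
    unfold polar; simpl; auto_derive; trivial; ring.
Qed.

Lemma polar_continuous (f : C -> C) (z c l : C) (t th : R) :
  has_cderiv f (polar z t th) l ->
  continuity_2d_pt (fun s a => Re (c * f (polar z s a))) t th.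
Proof.
  intros Hf eps.
  assert (Hc := Cmod_ge_0 c).
  destruct (has_cderiv_continuous _ _ _ Hf (eps / (Cmod c + 1))) as [d [Hd H]].
  { apply Rdiv_lt_0_compat; [apply cond_pos|lra]. }
  assert (Hd2 : 0 < d / 2) by lra.
  assert (C1 : forall g : R -> R, (forall x, continuity_pt g x) -> forall s a,
    continuity_2d_pt (fun x _ => g x) s a /\ continuity_2d_pt (fun _ y => g y) s a).
  { intros g Hg s a. split.
    - apply (continuity_1d_2d_pt_comp g (fun x _ => x)); [apply Hg|apply continuity_2d_pt_id1].
    - apply (continuity_1d_2d_pt_comp g (fun _ y => y)); [apply Hg|apply continuity_2d_pt_id2]. }
  assert (Ce := fun x => derivable_continuous_pt _ _ (derivable_pt_exp x)).
  assert (Cs := fun x => derivable_continuous_pt _ _ (derivable_pt_sin x)).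
  assert (Cc := fun x => derivable_continuous_pt _ _ (derivable_pt_cos x)).
  assert (X : continuity_2d_pt (fun s a => fst (polar z s a)) t th).
  { unfold polar; simpl.
    apply continuity_2d_pt_mult; [apply (C1 exp Ce)|].
    apply continuity_2d_pt_minus; apply continuity_2d_pt_mult;
      try apply continuity_2d_pt_const; [apply (C1 cos Cc)|apply (C1 sin Cs)]. }
  assert (Y : continuity_2d_pt (fun s a => snd (polar z s a)) t th).
  { unfold polar; simpl.
    apply continuity_2d_pt_mult; [apply (C1 exp Ce)|].
    apply continuity_2d_pt_plus; apply continuity_2d_pt_mult;
      try apply continuity_2d_pt_const; [apply (C1 sin Cs)|apply (C1 cos Cc)]. }
  assert (XY := locally_2d_and _ _ _ _ (X (mkposreal _ Hd2)) (Y (mkposreal _ Hd2))).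
  revert XY. apply locally_2d_impl. apply locally_2d_forall. simpl pos. intros s a [H1 H2].
  replace (Re (c * f (polar z s a)) - Re (c * f (polar z t th)))
    with (Re (c * (f (polar z s a) - f (polar z t th)))) by (simpl; ring).
  eapply Rle_lt_trans; [apply re_le_Cmod|]. rewrite Cmod_mult.
  assert (K : Cmod (f (polar z s a) - f (polar z t th)) < eps / (Cmod c + 1)).
  { apply H.
    set (P := polar z s a) in *. set (Q := polar z t th) in *.
    replace (P - Q)%C with (RtoC (fst P - fst Q)%R + RtoC (snd P - snd Q)%R * Ci)%C
      by (apply injective_projections; simpl; ring).
    eapply Rle_lt_trans; [apply Cmod_triangle|].
    rewrite Cmod_mult, Cmod_Ci, !Cmod_R. lra. }
  apply Rmult_lt_compat_r with (r := Cmod c + 1) in K; [|lra].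
  replace (eps / (Cmod c + 1) * (Cmod c + 1)) with (pos eps) in K by (field; lra).
  assert (T := Cmod_ge_0 (f (polar z s a) - f (polar z t th))). lra.
Qed.

(** [k] stands for [z u'] and [m] for [z k'], the derivatives in logarithmic coordinates. *)
Lemma boundary_maximum (u k m : C -> C) (z1 c : C) (L delta B rho : R) :
  z1 <> RtoC 0 -> 0 < L -> Cmod z1 * exp L < 1 -> 0 < delta ->
  (forall z, z <> RtoC 0 -> Cmod z < 1 -> has_cderiv u z (k z / z)%C) ->
  (forall z, z <> RtoC 0 -> Cmod z < 1 -> has_cderiv k z (m z / z)%C) ->
  0 < rho -> 0 <= B ->
  (forall z, z <> RtoC 0 -> Cmod z < rho -> Re (c * u z) <= B) ->
  0 <= Re (c * u z1) ->
  exists z, Cmod z = Cmod z1 * exp L /\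
    Re (c * u z1) <= Re (c * u z) + delta * (L + exp L) /\
    0 <= Re (c * k z) + delta * (1 + exp L).
Proof.
  intros Hz HL HzL Hd Hu Hk Hrho HB HuB Hpos.
  assert (Hz0 := proj1 (Cmod_gt_0 z1) Hz).
  set (F := fun t th => Re (c * u (polar z1 t th)) + delta * (t + exp t)).
  (* Chosen so that the edge [t = - T] loses to the value at [z1]: since [exp T > 1 + T], the
     summand [Cmod z1 / rho] brings this edge within [rho] of 0, where [B] applies, and
     [B / delta + 1] makes [delta * t] outweigh [B] there. *)
  set (T := B / delta + Cmod z1 / rho + 1).
  assert (HBd : 0 <= B / delta) by (apply Rdiv_le_0_compat; lra).
  assert (Hzr : 0 < Cmod z1 / rho) by (apply Rdiv_lt_0_compat; lra).
  assert (HT : 0 < T) by (unfold T; lra).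
  assert (Hin : forall t th, t <= L -> Cmod (polar z1 t th) < 1).
  { intros t th Ht. rewrite Cmod_polar. eapply Rle_lt_trans; [|exact HzL].
    apply Rmult_le_compat_l; [lra|].
    destruct Ht as [Ht| ->]; [left; now apply exp_increasing|lra]. }
  assert (Hne : forall t th, polar z1 t th <> RtoC 0) by (intros; now apply polar_neq_0).
  assert (HPI := PI_RGT_0).
  assert (HPI1 := PI2_1).
  destruct (rectangle_max F (- T) L (- PI) PI) as [t0 [th0 [Ht0 [Hth0 Hmax]]]]; [lra|lra| |].
  { intros t th Ht _. unfold F.
    apply continuity_2d_pt_plus.
    - eapply polar_continuous. apply Hu; [apply Hne|now apply Hin].
    - apply (continuity_1d_2d_pt_comp (fun x => delta * (x + exp x)) (fun x _ => x));
        [|apply continuity_2d_pt_id1].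
      apply derivable_continuous_pt. reg. }
  assert (Hlow : t0 <> - T).
  { intros E.
    assert (H0 : F 0 0 <= F t0 th0) by (apply Hmax; lra).
    unfold F in H0. rewrite polar_0, exp_0 in H0.
    assert (ET : exp (- T) < 1) by (rewrite <- exp_0; apply exp_increasing; lra).
    assert (Hb : Re (c * u (polar z1 t0 th0)) <= B).
    { apply HuB; [apply Hne|]. rewrite Cmod_polar, E, exp_Ropp.
      apply (Rlt_div_l _ _ _ (exp_pos T)).
      assert (G := exp_ineq1 T (Rgt_not_eq _ _ HT)).
      assert (G2 : Cmod z1 / rho < exp T) by (unfold T in *; lra).
      apply Rmult_lt_compat_l with (r := rho) in G2; [|lra].
      replace (rho * (Cmod z1 / rho)) with (Cmod z1) in G2 by (field; lra). exact G2. }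
    rewrite E in H0 at 2. rewrite E in H0 at 2.
    assert (delta * T = B + delta * (Cmod z1 / rho + 1)) by (unfold T; field; lra).
    assert (delta * exp (- T) < delta * 1) by now apply Rmult_lt_compat_l.
    assert (0 < delta * (Cmod z1 / rho)) by now apply Rmult_lt_0_compat.
    lra. }
  assert (Hdt : forall t th, t <= L ->
    is_derive (fun s => F s th) t (Re (c * k (polar z1 t th)) + delta * (1 + exp t))).
  { intros t th Ht. unfold F.
    apply (is_derive_plus (fun s => Re (c * u (polar z1 s th))) (fun s => delta * (s + exp s))).
    - apply polar_derive_radial; [apply Hne|]. apply Hu; [apply Hne|now apply Hin].
    - auto_derive; trivial; ring. }
  exists (polar z1 L th0). split; [apply Cmod_polar|].
  destruct (Rle_lt_or_eq_dec t0 L (proj2 Ht0)) as [HtL|HtL].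
  (* For [t0 < L] the second derivatives in [t] and [th] are [mm + delta * exp t0] and [- mm]; both
     would be nonpositive, but their sum is positive. *)
  - exfalso.
    set (eta := Rmin (L - t0) (t0 + T)).
    assert (Heta : 0 < eta) by (apply Rmin_pos; lra).
    assert (Hnear : forall t, Rabs (t - t0) < eta -> - T <= t <= L).
    { intros t Ht. assert (E1 := Rmin_l (L - t0) (t0 + T)). assert (E2 := Rmin_r (L - t0) (t0 + T)).
      apply Rabs_def2 in Ht. fold eta in E1, E2. lra. }
    set (mm := Re (c * m (polar z1 t0 th0))).
    assert (A1 : mm + delta * exp t0 <= 0).
    { apply (second_derivative_test (fun t => F t th0)
        (fun t => Re (c * k (polar z1 t th0)) + delta * (1 + exp t)) t0 _ eta Heta).
      - intros t Ht. apply Hdt. now apply Hnear.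
      - apply (is_derive_plus (fun s => Re (c * k (polar z1 s th0))) (fun s => delta * (1 + exp s))).
        + apply polar_derive_radial; [apply Hne|]. apply Hk; [apply Hne|now apply Hin].
        + auto_derive; trivial; ring.
      - intros t Ht. apply Hmax; [now apply Hnear|lra]. }
    assert (A2 : - mm <= 0).
    { replace (- mm) with (Re (c * Ci * Ci * m (polar z1 t0 th0))) by (unfold mm; simpl; ring).
      apply (second_derivative_test (fun a => F t0 a)
        (fun a => Re (c * Ci * k (polar z1 t0 a))) th0 _ 1 Rlt_0_1).
      - intros a _. unfold F.
        rewrite <- (Rplus_0_r (Re _)).
        apply (is_derive_plus (fun s => Re (c * u (polar z1 t0 s))) (fun _ => delta * (t0 + exp t0)));
          [|auto_derive; trivial].
        apply polar_derive_angular; [apply Hne|]. apply Hu; [apply Hne|now apply Hin].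
      - apply polar_derive_angular; [apply Hne|]. apply Hk; [apply Hne|now apply Hin].
      - intros a Ha. apply Rabs_def2 in Ha.
        (* The window of radius 1 around [th0] may leave the rectangle; a shift by a period brings
           it back. *)
        assert (Per : forall x, F t0 (x + 2 * PI) = F t0 x).
        { intros x. unfold F, polar. rewrite sin_plus, cos_plus, sin_2PI, cos_2PI.
          now rewrite !Rmult_1_r, !Rmult_0_r, Rminus_0_r, Rplus_0_r. }
        destruct (Rle_lt_dec a PI) as [Hp|Hp].
        + destruct (Rle_lt_dec (- PI) a) as [Hp'|Hp'].
          * apply Hmax; lra.
          * rewrite <- (Per a). apply Hmax; lra.
        + replace a with (a - 2 * PI + 2 * PI) by ring. rewrite Per. apply Hmax; lra. }
    assert (0 < delta * exp t0) by (apply Rmult_lt_0_compat; [lra|apply exp_pos]).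
    lra.
  - subst t0. split.
    + assert (H0 : F 0 0 <= F L th0) by (apply Hmax; lra).
      unfold F in H0. rewrite polar_0, exp_0 in H0. lra.
    + apply (left_max_derivative (fun s => F s th0) L _ (L + T)); [lra| |].
      * apply Hdt; lra.
      * intros t Ht. apply Hmax; lra.
Qed.

(** * Chain rule and the inverse of the cubic [x - x^3 / 3] *)

Lemma has_cderiv_comp (f g : C -> C) (z lf lg : C) :
  has_cderiv f (g z) lf -> has_cderiv g z lg ->
  has_cderiv (fun y => f (g y)) z (lf * lg)%C.
Proof.
  intros Hf Hg eps Heps.
  assert (Hlf := Cmod_ge_0 lf). assert (Hlg := Cmod_ge_0 lg).
  destruct (Hf (eps / (2 * (Cmod lg + 1)))) as [d1 [Hd1 H1]].
  { apply Rdiv_lt_0_compat; lra. }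
  set (e2 := Rmin 1 (eps / (2 * (Cmod lf + 1)))).
  assert (He2 : 0 < e2) by (apply Rmin_pos; [lra|apply Rdiv_lt_0_compat; lra]).
  destruct (Hg e2 He2) as [d2 [Hd2 H2]].
  destruct (has_cderiv_continuous _ _ _ Hg d1 Hd1) as [d3 [Hd3 H3]].
  exists (Rmin d2 d3). split; [now apply Rmin_pos|].
  intros y Hy.
  specialize (H2 y (Rlt_le_trans _ _ _ Hy (Rmin_l _ _))).
  specialize (H1 (g y) (H3 y (Rlt_le_trans _ _ _ Hy (Rmin_r _ _)))).
  set (h := Cmod (y - z)) in *. assert (Hh : 0 <= h) by apply Cmod_ge_0.
  replace (f (g y) - f (g z) - (y - z) * (lf * lg))%C with
    ((f (g y) - f (g z) - (g y - g z) * lf) + (g y - g z - (y - z) * lg) * lf)%C by ring.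
  eapply Rle_trans; [apply Cmod_triangle|]. rewrite Cmod_mult.
  assert (Hgg : Cmod (g y - g z) <= (Cmod lg + 1) * h).
  { replace (g y - g z)%C with ((g y - g z - (y - z) * lg) + (y - z) * lg)%C by ring.
    eapply Rle_trans; [apply Cmod_triangle|]. rewrite Cmod_mult. fold h.
    assert (e2 * h <= 1 * h) by (apply Rmult_le_compat_r; [easy|apply Rmin_l]). lra. }
  assert (A1 : eps / (2 * (Cmod lg + 1)) * Cmod (g y - g z) <= eps / 2 * h).
  { replace (eps / 2 * h) with (eps / (2 * (Cmod lg + 1)) * ((Cmod lg + 1) * h)) by (field; lra).
    apply Rmult_le_compat_l; [|easy]. left. apply Rdiv_lt_0_compat; lra. }
  assert (A2 : Cmod (g y - g z - (y - z) * lg) * Cmod lf <= eps / 2 * h).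
  { apply Rle_trans with (eps / (2 * (Cmod lf + 1)) * h * (Cmod lf + 1)).
    - apply Rmult_le_compat; [apply Cmod_ge_0|easy| |lra].
      eapply Rle_trans; [exact H2|]. apply Rmult_le_compat_r; [easy|apply Rmin_r].
    - right. field. lra. }
  lra.
Qed.

(** Factor out [a - b]: each of the three products in [a^2 + ab + b^2] has modulus at most [r^2].
    For [r < 1] the cubic term is thus a contraction. *)
Lemma cube_lipschitz (a b : C) (r : R) :
  Cmod a <= r -> Cmod b <= r -> Cmod (a ^ 3 / 3 - b ^ 3 / 3) <= r ^ 2 * Cmod (a - b).
Proof.
  intros Ha Hb.
  assert (Ha0 := Cmod_ge_0 a). assert (Hb0 := Cmod_ge_0 b).
  replace (a ^ 3 / 3 - b ^ 3 / 3)%C with ((a * a + a * b + b * b) / 3 * (a - b))%C by field.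
  rewrite Cmod_mult. apply Rmult_le_compat_r; [apply Cmod_ge_0|].
  rewrite Cmod_div by (apply RtoC_neq_0; lra).
  rewrite Cmod_R, Rabs_pos_eq by lra.
  apply Rle_div_l; [lra|].
  eapply Rle_trans; [apply Cmod_triangle|].
  eapply Rle_trans; [apply Rplus_le_compat_r, Cmod_triangle|].
  rewrite !Cmod_mult.
  assert (Cmod a * Cmod a <= r * r) by (apply Rmult_le_compat; lra).
  assert (Cmod a * Cmod b <= r * r) by (apply Rmult_le_compat; lra).
  assert (Cmod b * Cmod b <= r * r) by (apply Rmult_le_compat; lra).
  lra.
Qed.

Lemma geometric_increments_lim (x : nat -> R) (q : R) :
  0 <= q < 1 -> (forall n, Rabs (x (S n) - x n) <= q ^ n) ->
  exists l : R, is_lim_seq x l.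
Proof.
  intros Hq H.
  destruct (ex_series_le (fun n => x (S n) - x n) (fun n => q ^ n)) as [l Hl].
  - exact H.
  - exists (/ (1 - q)). apply is_series_geom. rewrite Rabs_pos_eq; lra.
  - exists (l + x O). apply is_lim_seq_incr_1.
    apply is_lim_seq_ext with (fun n => sum_n (fun n => x (S n) - x n) n + x O).
    + induction n as [|n IH]; [rewrite sum_O; ring|].
      rewrite sum_Sn. unfold plus; simpl. lra.
    + apply (is_lim_seq_plus' _ (fun _ => x O)); [exact Hl|apply is_lim_seq_const].
Qed.

(** Iterate [x -> u + x^3 / 3] from 0. The bound on [u] keeps the iterates in the disc of radius
    [r], where the map contracts by [r^2]; limits are taken separately in the real and imaginary
    parts. *)
Lemma cubic_solution (u : C) (r : R) :
  0 < r < 1 -> Cmod u <= r - r ^ 3 / 3 ->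
  exists x : C, Cmod x <= r /\ (x - x ^ 3 / 3)%C = u.
Proof.
  intros Hr Hu.
  set (x := fix x n := match n with O => RtoC 0 | S n => (u + x n ^ 3 / 3)%C end).
  assert (xS : forall n, x (S n) = (u + x n ^ 3 / 3)%C) by easy.
  assert (Hx : forall n, Cmod (x n) <= r).
  { induction n as [|n IH]; [simpl x; rewrite Cmod_0; lra|].
    rewrite xS.
    eapply Rle_trans; [apply Cmod_triangle|].
    rewrite Cmod_div, Cmod_pow, Cmod_R, Rabs_pos_eq by (try lra; apply RtoC_neq_0; lra).
    assert (Cmod (x n) ^ 3 <= r ^ 3) by (apply pow_incr; split; [apply Cmod_ge_0|easy]).
    lra. }
  assert (Hr2 : 0 <= r ^ 2 < 1) by nra.
  assert (Hd : forall n, Cmod (x (S n) - x n) <= (r ^ 2) ^ n).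
  { induction n as [|n IH].
    - replace (x 1%nat - x 0%nat)%C with (x 1%nat) by (simpl; ring).
      eapply Rle_trans; [apply Hx|]. simpl; lra.
    - replace (x (S (S n)) - x (S n))%C with (x (S n) ^ 3 / 3 - x n ^ 3 / 3)%C
        by (rewrite (xS (S n)), (xS n); ring).
      eapply Rle_trans; [now apply cube_lipschitz|].
      simpl pow at 2. apply Rmult_le_compat_l; [apply Hr2|exact IH]. }
  destruct (geometric_increments_lim (fun n => fst (x n)) _ Hr2) as [a Ha].
  { intros n. eapply Rle_trans; [|apply (Hd n)]. apply (re_le_Cmod (x (S n) - x n)%C). }
  destruct (geometric_increments_lim (fun n => snd (x n)) _ Hr2) as [b Hb].
  { intros n. eapply Rle_trans; [|apply (Hd n)].
    eapply Rle_trans; [|apply (Rmax_Cmod (x (S n) - x n)%C)]. apply Rmax_r. }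
  apply is_lim_seq_spec in Ha. apply is_lim_seq_spec in Hb.
  assert (L : forall eps, 0 < eps -> exists N, forall n, (N <= n)%nat -> Cmod ((a, b) - x n) < eps).
  { intros eps Heps. assert (He2 : 0 < eps / 2) by lra.
    destruct (Ha (mkposreal _ He2)) as [N1 H1]. destruct (Hb (mkposreal _ He2)) as [N2 H2].
    exists (N1 + N2)%nat. intros n Hn.
    specialize (H1 n ltac:(lia)). specialize (H2 n ltac:(lia)). simpl in H1, H2.
    rewrite Cminus_swap_mod.
    replace (x n - (a, b))%C with (RtoC (fst (x n) - a)%R + RtoC (snd (x n) - b)%R * Ci)%C
      by (apply injective_projections; simpl; ring).
    eapply Rle_lt_trans; [apply Cmod_triangle|].
    rewrite Cmod_mult, Cmod_Ci, !Cmod_R. lra. }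
  assert (Hab : Cmod (a, b) <= r).
  { apply le_epsilon. intros eps Heps. destruct (L eps Heps) as [N HN].
    specialize (HN N (Nat.le_refl _)). assert (T := Cmod_triangle_inv (a, b) (x N)).
    specialize (Hx N). lra. }
  exists (a, b). split; [exact Hab|].
  set (z := (a, b) : C) in *.
  cut (Cmod (z - z ^ 3 / 3 - u) <= 0).
  { intros H. replace (z - z ^ 3 / 3)%C with (z - z ^ 3 / 3 - u + u)%C by ring.
    rewrite (Cmod_eq_0 (z - z ^ 3 / 3 - u)%C); [ring|].
    apply Rle_antisym; [exact H|apply Cmod_ge_0]. }
  apply le_epsilon. intros eps Heps. destruct (L (eps / 2)) as [N HN]; [lra|].
  assert (H1 := HN N (Nat.le_refl _)). assert (H2 := HN (S N) (le_S _ _ (Nat.le_refl _))).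
  (* The recurrence eliminates [u]; the second difference is at most [r^2] times the distance from
     [z] to [x N]. *)
  replace (z - z ^ 3 / 3 - u)%C with ((z - x (S N)) + (x N ^ 3 / 3 - z ^ 3 / 3))%C
    by (rewrite xS; ring).
  eapply Rle_trans; [apply Cmod_triangle|].
  assert (T := cube_lipschitz (x N) z r (Hx N) Hab). rewrite (Cminus_swap_mod (x N)) in T.
  assert (T2 := Cmod_ge_0 (z - x N)). nra.
Qed.

Lemma cubic_inverse :
  exists h : C -> C, forall u, Cmod u < 2 / 3 ->
    Cmod (h u) < 1 /\ (h u - h u ^ 3 / 3)%C = u.
Proof.
  apply (functional_choice (fun u x => Cmod u < 2 / 3 -> Cmod x < 1 /\ (x - x ^ 3 / 3)%C = u)).
  intros u. destruct (Rlt_le_dec (Cmod u) (2 / 3)) as [Hu|Hu].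
  - assert (Hu0 := Cmod_ge_0 u).
    (* With [r = 1/3 + |u| < 1] one gets [r - r^3/3 - |u| = (1 - r^3)/3 > 0]. *)
    destruct (cubic_solution u (1 / 3 + Cmod u)) as [x [Hx1 Hx2]]; [lra|nra|].
    exists x. intros _. split; [lra|exact Hx2].
  - exists (RtoC 0). intros H. exfalso. lra.
Qed.

(** With [a = h u] and [b = h u0], both [u - u0 = (a - b) (1 - (a^2 + ab + b^2) / 3)] and
    [a - b - (u - u0) / (1 - b^2) = (a - b)^2 (a + 2 b) / (3 (1 - b^2))] hold; as [|a| < 1],
    the first one makes [h] Lipschitz at [u0]. *)
Lemma cubic_inverse_derive (h : C -> C) (u0 : C) :
  (forall u, Cmod u < 2 / 3 -> Cmod (h u) < 1 /\ (h u - h u ^ 3 / 3)%C = u) ->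
  Cmod u0 < 2 / 3 ->
  has_cderiv h u0 (/ (1 - h u0 ^ 2))%C.
Proof.
  intros Hh Hu0 eps Heps.
  destruct (Hh u0 Hu0) as [Hb Eb]. set (b := h u0) in *.
  assert (Hb0 := Cmod_ge_0 b).
  (* A lower bound for [|1 - (a^2 + ab + b^2) / 3|] valid for all [|a| < 1], and positive as
     [|b| < 1]. *)
  set (kap := 1 - (1 + Cmod b + Cmod b ^ 2) / 3).
  assert (Hkap : 0 < kap) by (unfold kap; nra).
  assert (Hnz : 0 < Cmod (1 - b ^ 2)).
  { eapply Rlt_le_trans; [|apply Cmod_triangle_inv]. rewrite Cmod_1, Cmod_pow. nra. }
  assert (Hnz' : (1 - b ^ 2)%C <> RtoC 0) by now apply Cmod_gt_0.
  (* From [kap |a - b| <= d] and [d < eps M] follows [|a - b|^2 <= eps |1 - b^2| d], the bound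
     needed at the end. *)
  set (M := kap * kap * Cmod (1 - b ^ 2)).
  assert (HM : 0 < M) by (unfold M; repeat apply Rmult_lt_0_compat; lra).
  exists (Rmin (2 / 3 - Cmod u0) (eps * M)). split.
  { apply Rmin_pos; [lra|]. now apply Rmult_lt_0_compat. }
  intros u Hu.
  assert (Hu1 := Rlt_le_trans _ _ _ Hu (Rmin_l _ _)).
  assert (Hu2 := Rlt_le_trans _ _ _ Hu (Rmin_r _ _)).
  destruct (Hh u) as [Ha Ea].
  { assert (T := Cmod_triangle_inv u u0). lra. }
  set (a := h u) in *. assert (Ha0 := Cmod_ge_0 a).
  assert (E : (u - u0)%C = ((a - b) - (a - b) * ((a * a + a * b + b * b) / 3))%C)
    by (rewrite <- Ea, <- Eb; field).
  set (d := Cmod (u - u0)) in *.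
  assert (Hd0 : 0 <= d) by apply Cmod_ge_0.
  assert (Lip : kap * Cmod (a - b) <= d).
  { unfold d. rewrite E. eapply Rle_trans; [|apply Cmod_triangle_inv].
    rewrite Cmod_mult, Cmod_div, Cmod_R, Rabs_pos_eq by (try lra; apply RtoC_neq_0; lra).
    assert (T : Cmod (a * a + a * b + b * b) <= 1 + Cmod b + Cmod b ^ 2).
    { eapply Rle_trans; [apply Cmod_triangle|].
      eapply Rle_trans; [apply Rplus_le_compat_r, Cmod_triangle|].
      rewrite !Cmod_mult. nra. }
    assert (T2 := Cmod_ge_0 (a - b)). unfold kap. nra. }
  replace (a - b - (u - u0) * / (1 - b ^ 2))%C with
    ((a - b) * (a - b) * (a + 2 * b) / 3 / (1 - b ^ 2))%C
    by (rewrite E; field; exact Hnz').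
  rewrite !Cmod_div, !Cmod_mult, Cmod_R, Rabs_pos_eq
    by (try lra; try exact Hnz'; apply RtoC_neq_0; lra).
  assert (T3 : Cmod (a + 2 * b) / 3 <= 1).
  { apply Rle_div_l; [lra|]. eapply Rle_trans; [apply Cmod_triangle|].
    rewrite Cmod_mult, Cmod_R, Rabs_pos_eq by lra. lra. }
  apply Rle_div_l; [exact Hnz|].
  set (e := Cmod (a - b)) in *. assert (He : 0 <= e) by apply Cmod_ge_0.
  assert (T4 : e * e * Cmod (a + 2 * b) / 3 <= e * e).
  { replace (e * e * Cmod (a + 2 * b) / 3) with (e * e * (Cmod (a + 2 * b) / 3)) by field.
    assert (0 <= e * e) by nra. nra. }
  assert (T5 : kap * kap * (e * e) <= d * d).
  { replace (kap * kap * (e * e)) with ((kap * e) * (kap * e)) by ring.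
    apply Rmult_le_compat; try apply Rmult_le_pos; lra. }
  assert (T6 : d * d <= eps * M * d) by nra.
  eapply Rle_trans; [exact T4|].
  apply Rmult_le_reg_l with (kap * kap); [now apply Rmult_lt_0_compat|].
  unfold M in T6. nra.
Qed.

(** * The bound on [q] from the differential equation *)

Lemma ode_bound (q w dq : C -> C) (beta : R) :
  0 < beta -> q (RtoC 0) = RtoC 0 ->
  (forall z, Cmod z < 1 -> has_cderiv q z (dq z)) ->
  (forall z, Cmod z < 1 -> exists l, has_cderiv w z l) ->
  (forall z, Cmod z < 1 -> (q z + RtoC beta * z * dq z)%C = w z) ->
  (forall z, Cmod z < 1 -> Cmod (w z) <= 1) ->
  forall z, Cmod z < 1 -> (1 + beta) * Cmod (q z) <= Cmod z.
Proof.
  intros Hbeta Hq0 Hq Hw Eq Hw1 z1 Hz1.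
  destruct (Ceq_dec z1 0) as [->|Hz]; [rewrite Hq0, Cmod_0; lra|].
  assert (Hz0 := proj1 (Cmod_gt_0 z1) Hz).
  assert (Hbc : RtoC beta <> RtoC 0) by (apply RtoC_neq_0; lra).
  destruct (functional_choice (fun z l => Cmod z < 1 -> has_cderiv w z l)) as [dw Hdw].
  { intros z. destruct (Rlt_le_dec (Cmod z) 1) as [H|H].
    - destruct (Hw z H) as [l Hl]. now exists l.
    - exists (RtoC 0). intros H'. lra. }
  set (u := fun z => (q z / z)%C).
  (* By the equation, [g] is [z q' - q] written without [q'], hence differentiable. So [k = g / z]
     is [z u'], and [m = g' - g / z] is [z k']. *)
  set (g := fun z => (/ beta * w z + - ((1 + beta) / beta) * q z)%C).
  set (k := fun z => (g z / z)%C).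
  set (m := fun z => (/ beta * dw z + - ((1 + beta) / beta) * dq z - g z / z)%C).
  assert (Hu : forall z, z <> RtoC 0 -> Cmod z < 1 -> has_cderiv u z (k z / z)%C).
  { intros z Hz' Hz1'. replace (k z / z)%C with ((dq z - q z / z) / z)%C.
    - apply has_cderiv_div_id; [easy|now apply Hq].
    - unfold k, g. rewrite <- (Eq z Hz1'). field. now split. }
  assert (Hk : forall z, z <> RtoC 0 -> Cmod z < 1 -> has_cderiv k z (m z / z)%C).
  { intros z Hz' Hz1'. apply (has_cderiv_div_id g); [easy|].
    apply has_cderiv_linear; [now apply Hdw|now apply Hq]. }
  assert (Ek : forall z, z <> RtoC 0 -> ((1 + beta) * u z + beta * k z)%C = (w z / z)%C).
  { intros z Hz'. unfold u, k, g. field. now split. }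
  (* Differentiability at 0 with tolerance 1 bounds [|q z / z|] by [|q'(0)| + 1] near 0, which
     provides [B] and [rho]. *)
  destruct (Hq 0) with (eps := 1) as [rho [Hrho HB]]; [rewrite Cmod_0; lra|lra|].
  assert (Key : forall L, 0 < L -> Cmod z1 * exp L < 1 ->
    (1 + beta) * Cmod (u z1) <= / (Cmod z1 * exp L)).
  { intros L HL HzL.
    assert (HeL := exp_pos L).
    assert (Hr : 0 < Cmod z1 * exp L) by now apply Rmult_lt_0_compat.
    destruct (Ceq_dec (u z1) 0) as [E0|Hu1].
    { rewrite E0, Cmod_0, Rmult_0_r. left. now apply Rinv_0_lt_compat. }
    assert (Hu0 := proj1 (Cmod_gt_0 (u z1)) Hu1).
    assert (Hu0' : RtoC (Cmod (u z1)) <> RtoC 0) by (apply RtoC_neq_0; lra).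
    (* The unimodular factor that rotates [u z1] onto the positive axis. *)
    set (c := (Cconj (u z1) / Cmod (u z1))%C).
    assert (Hc : Cmod c = 1).
    { unfold c. rewrite Cmod_div, Cmod_conj, Cmod_R, Rabs_pos_eq by (try easy; lra). field. lra. }
    assert (Ec : Re (c * u z1) = Cmod (u z1)).
    { replace (c * u z1)%C with (RtoC (Cmod (u z1))); [easy|].
      unfold c. replace (Cconj (u z1) / Cmod (u z1) * u z1)%C
        with (u z1 * Cconj (u z1) / Cmod (u z1))%C by (field; easy).
      rewrite <- Cmod2_conj, RtoC_pow. field. easy. }
    (* The two error terms of [boundary_maximum], weighted by [1 + beta] and [beta], add up to
       [delta * K]; so [delta = eps / K]. *)
    set (K := (1 + beta) * (L + exp L) + beta * (1 + exp L)).
    assert (HK : 0 < K).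
    { unfold K. apply Rplus_lt_0_compat; apply Rmult_lt_0_compat; lra. }
    apply le_epsilon. intros eps Heps.
    destruct (boundary_maximum u k m z1 c L (eps / K) (Cmod (dq 0) + 1) rho)
      as [z [Hz' [I1 I2]]]; try easy.
    - now apply Rdiv_lt_0_compat.
    - assert (T := Cmod_ge_0 (dq 0)). lra.
    - intros z Hz' Hzr.
      eapply Rle_trans; [apply Rle_abs|]. eapply Rle_trans; [apply re_le_Cmod|].
      rewrite Cmod_mult, Hc, Rmult_1_l. unfold u.
      rewrite Cmod_div by easy.
      assert (Hzp := proj1 (Cmod_gt_0 z) Hz'). apply Rle_div_l; [easy|].
      specialize (HB z). rewrite Hq0 in HB.
      replace (z - 0)%C with z in HB by ring. specialize (HB Hzr).
      replace (q z) with ((q z - 0 - z * dq 0) + z * dq 0)%C by ring.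
      eapply Rle_trans; [apply Cmod_triangle|]. rewrite Cmod_mult. lra.
    - rewrite Ec. lra.
    - rewrite Ec in I1.
      assert (Hzz : z <> RtoC 0) by (apply Cmod_gt_0; lra).
      assert (W : (1 + beta) * Re (c * u z) + beta * Re (c * k z) <= / (Cmod z1 * exp L)).
      { replace ((1 + beta) * Re (c * u z) + beta * Re (c * k z)) with (Re (c * (w z / z))).
        - eapply Rle_trans; [apply Rle_abs|]. eapply Rle_trans; [apply re_le_Cmod|].
          rewrite Cmod_mult, Hc, Rmult_1_l, Cmod_div by easy. rewrite Hz'.
          rewrite <- (Rmult_1_l (/ _)). apply Rmult_le_compat_r.
          + left. now apply Rinv_0_lt_compat.
          + apply Hw1. lra.
        - rewrite <- (Ek z Hzz). simpl. ring. }
      assert (eps = (1 + beta) * (eps / K * (L + exp L)) + beta * (eps / K * (1 + exp L))).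
      { transitivity (eps / K * K); [field; lra|]. unfold K at 2. ring. }
      assert ((1 + beta) * Cmod (u z1) <= (1 + beta) * (Re (c * u z) + eps / K * (L + exp L)))
        by (apply Rmult_le_compat_l; lra).
      assert (0 <= beta * (Re (c * k z) + eps / K * (1 + exp L)))
        by (apply Rmult_le_pos; lra).
      lra. }
  assert (Key2 : forall r, Cmod z1 < r < 1 -> (1 + beta) * Cmod (q z1) * r <= Cmod z1).
  { intros r Hr.
    assert (E : Cmod z1 * exp (ln (r / Cmod z1)) = r).
    { rewrite exp_ln by (apply Rdiv_lt_0_compat; lra). field. lra. }
    assert (T := Key (ln (r / Cmod z1))). rewrite E in T.
    unfold u in T. rewrite Cmod_div in T by easy.
    apply Rmult_le_reg_r with (/ (Cmod z1 * r)).
    { apply Rinv_0_lt_compat. apply Rmult_lt_0_compat; lra. }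
    replace ((1 + beta) * Cmod (q z1) * r * / (Cmod z1 * r))
      with ((1 + beta) * (Cmod (q z1) / Cmod z1)) by (field; lra).
    replace (Cmod z1 * / (Cmod z1 * r)) with (/ r) by (field; lra).
    apply T; [|lra]. rewrite <- ln_1. apply ln_increasing; [lra|].
    apply Rlt_div_r; lra. }
  set (X := (1 + beta) * Cmod (q z1)) in *.
  destruct (Rle_lt_dec X (Cmod z1)) as [|HX]; [easy|exfalso].
  (* If [X > |z1|], any radius strictly between [s] and 1 contradicts [Key2]; the midpoint is
     taken. *)
  set (s := Rmax (Cmod z1) (Cmod z1 / X)).
  assert (Hs1 : Cmod z1 <= s) by apply Rmax_l.
  assert (Hs2 : Cmod z1 / X <= s) by apply Rmax_r.
  assert (Hs3 : s < 1).
  { apply Rmax_lub_lt; [easy|]. apply Rlt_div_l; lra. }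
  assert (T := Key2 ((s + 1) / 2) ltac:(lra)).
  apply Rle_div_l in Hs2; [|lra]. nra.
Qed.

(** * Subordination to [phi_Ne], sharpness and the theorem *)

Lemma analytic_has_cderiv (f : C -> C) (z : C) :
  analytic_on_disc f -> in_disc z -> has_cderiv f z (C_derive f z).
Proof.
  intros Hf Hz. apply is_derive_has_cderiv.
  apply C_derive_correct; [exact z|]. now apply Hf.
Qed.

Lemma has_cderiv_ex_derive (f : C -> C) (z l : C) :
  has_cderiv f z l -> @ex_derive C_AbsRing C_NormedModule f z.
Proof. intros H. exists l. now apply is_derive_has_cderiv. Qed.

Lemma has_cderiv_affine (a b z : C) : has_cderiv (fun y => a + b * y)%C z b.
Proof.
  intros eps Heps. exists 1. split; [lra|]. intros y _.
  replace (a + b * y - (a + b * z) - (y - z) * b)%C with (RtoC 0) by ring.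
  rewrite Cmod_0. apply Rmult_le_pos; [lra|apply Cmod_ge_0].
Qed.

Lemma subordinate_phi_Ne (p : C -> C) :
  analytic_on_disc p -> p (RtoC 0) = RtoC 1 ->
  (forall z, in_disc z -> Cmod (p z - 1) < 2 / 3) ->
  subordinate p phi_Ne.
Proof.
  intros Hp Hp0 Hb. destruct cubic_inverse as [h Hh].
  (* This is [h (p z - 1)], with the argument in the shape of [has_cderiv_affine]. *)
  exists (fun z => h (-1 + 1 * p z)%C).
  assert (E : forall z, (-1 + 1 * p z)%C = (p z - 1)%C) by (intros; ring).
  repeat split.
  - intros z Hz. eapply has_cderiv_ex_derive.
    apply (has_cderiv_comp h (fun z => -1 + 1 * p z)%C).
    + apply cubic_inverse_derive; [exact Hh|]. rewrite E. now apply Hb.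
    + apply (has_cderiv_comp (fun y => -1 + 1 * y)%C p); [apply has_cderiv_affine|].
      now apply analytic_has_cderiv.
  - destruct (Hh 0%C) as [H1 H2]; [rewrite Cmod_0; lra|].
    rewrite Hp0. replace (-1 + 1 * 1)%C with (RtoC 0) by ring.
    set (a := h 0%C) in *.
    (* [h] comes from a choice, so [h 0 = 0] needs an argument: a nonzero root of [a - a^3 / 3] has
       [a^2 = 3] and lies outside the disc. *)
    destruct (Ceq_dec a 0) as [|Ha]; [easy|exfalso].
    assert (E3 : (a ^ 2 = 3)%C).
    { replace (RtoC 3) with (a ^ 2 + 3 * (a - a ^ 3 / 3) / a)%C by (field; exact Ha).
      rewrite H2. field. exact Ha. }
    assert (E4 : Cmod a ^ 2 = 3) by (rewrite <- Cmod_pow, E3, Cmod_R, Rabs_pos_eq; lra).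
    assert (T := Cmod_ge_0 a). nra.
  - intros z Hz. apply Hh. rewrite E. now apply Hb.
  - intros z Hz. unfold phi_Ne.
    destruct (Hh (-1 + 1 * p z)%C) as [_ H2]; [rewrite E; now apply Hb|].
    replace (1 + h (-1 + 1 * p z) - h (-1 + 1 * p z) ^ 3 / 3)%C
      with (1 + (h (-1 + 1 * p z) - h (-1 + 1 * p z) ^ 3 / 3))%C by ring.
    rewrite H2. ring.
Qed.

(** For [z = a + i b] the imaginary part of [z - z^3 / 3] is [b (1 - a^2 + b^2 / 3)], whose second
    factor is positive in the disc, so [b = 0]. Then [2/3 - (a - a^3 / 3) = (1 - a)^2 (a + 2) / 3 >
    0]. *)
Lemma phi_Ne_real_values (x : R) (z : C) :
  Cmod z < 1 -> (RtoC 1 + RtoC x)%C = phi_Ne z -> x < 2 / 3.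
Proof.
  intros Hz E. destruct z as [a b].
  assert (H1 : a ^ 2 + b ^ 2 < 1).
  { assert (T := Cmod2_alt (a, b)). simpl Re in T. simpl Im in T.
    rewrite <- T. assert (T2 := Cmod_ge_0 (a, b)). nra. }
  assert (E' : (RtoC x = (a, b) - (1 / 3)%R * (a, b) ^ 3)%C).
  { replace (RtoC x) with (1 + x - 1)%C by ring. rewrite E. unfold phi_Ne.
    rewrite RtoC_div by lra. field. }
  assert (Ex := f_equal fst E'). assert (Ey := f_equal snd E'). simpl in Ex, Ey.
  assert (Hb : b = 0).
  { assert (F : b * (1 - a ^ 2 + b ^ 2 / 3) = 0) by (rewrite Ey; field).
    apply Rmult_integral in F. destruct F as [F|F]; [easy|nra]. }
  subst b. assert (F : x = a - a ^ 3 / 3) by (rewrite Ex; field).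
  assert (Ha : -1 < a < 1) by nra.
  assert (0 < (1 - a) * (1 - a) * (a + 2)) by (repeat apply Rmult_lt_0_compat; lra).
  rewrite F. nra.
Qed.

Theorem theorem5p2 :
  (forall (beta : R) (p : C -> C),
     0 < beta ->
     analytic_on_disc p ->
     p (RtoC 0) = RtoC 1 ->
     subordinate (fun z : C => (p z + RtoC beta * z * C_derive p z)%C)
                 (fun z : C => (1 + z)%C) ->
     1 / 2 <= beta ->
     subordinate p phi_Ne)
  /\
  (forall b : R,
     0 < b -> b < 1 / 2 ->
     ~ (forall (beta : R) (p : C -> C),
          0 < beta ->
          analytic_on_disc p ->
          p (RtoC 0) = RtoC 1 ->
          subordinate (fun z : C => (p z + RtoC beta * z * C_derive p z)%C)
                      (fun z : C => (1 + z)%C) ->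
          b <= beta ->
          subordinate p phi_Ne)).
Proof.
  split.
  - intros beta p Hbeta Hp Hp0 [w [Hw [_ [Hw1 Eq]]]] Hb.
    apply subordinate_phi_Ne; [easy|easy|].
    intros z Hz.
    assert (H := ode_bound (fun z => -1 + 1 * p z)%C w (C_derive p) beta Hbeta).
    assert (B : (1 + beta) * Cmod (-1 + 1 * p z) <= Cmod z).
    { apply H; try easy.
      - rewrite Hp0. ring.
      - intros y Hy. replace (C_derive p y) with (1 * C_derive p y)%C by ring.
        apply (has_cderiv_comp (fun y => -1 + 1 * y)%C p); [apply has_cderiv_affine|].
        now apply analytic_has_cderiv.
      - intros y Hy. eexists. now apply analytic_has_cderiv.
      - intros y Hy. specialize (Eq y Hy). simpl in Eq.
        replace (w y) with (1 + w y - 1)%C by ring. rewrite <- Eq. ring.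
      - intros y Hy. left. now apply Hw1. }
    replace (p z - 1)%C with (-1 + 1 * p z)%C by ring.
    (* Here [beta >= 1/2] enters: [|p z - 1| <= |z| / (1 + beta) < 2/3]. *)
    unfold in_disc in Hz. assert (T := Cmod_ge_0 (-1 + 1 * p z)). nra.
  - intros b Hb0 Hb H.
    (* With [beta = b] this [p] satisfies [p + b z p' = 1 + z] exactly, so the identity witnesses
       the subordination. *)
    set (p := fun z : C => (1 + / (1 + b)%R * z)%C).
    assert (Hb1 : RtoC (1 + b) <> RtoC 0) by (apply RtoC_neq_0; lra).
    assert (Hd : forall z, has_cderiv p z (/ (1 + b)%R)%C) by (intros; apply has_cderiv_affine).
    assert (S : subordinate p phi_Ne).
    { apply (H b p); [easy| | | |lra].
      - intros z _. eapply has_cderiv_ex_derive, Hd.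
      - unfold p. ring.
      - exists (fun z => 0 + 1 * z)%C. repeat split.
        + intros z _. eapply has_cderiv_ex_derive, has_cderiv_affine.
        + ring.
        + intros z Hz. replace (0 + 1 * z)%C with z by ring. exact Hz.
        + intros z _.
          rewrite (is_C_derive_unique p z (/ (1 + b)%R)%C) by now apply is_derive_has_cderiv.
          unfold p. rewrite RtoC_plus in *. field. exact Hb1. }
    destruct S as [w [_ [_ [Hw1 Ew]]]].
    (* The midpoint of [2/3 (1 + b)] and 1, in this order since [b < 1/2]: it lies in the disc,
       while [x / (1 + b) > 2/3]. *)
    set (x := (1 + 2 / 3 * (1 + b)) / 2).
    assert (Hx : in_disc x).
    { unfold in_disc. rewrite Cmod_R, Rabs_pos_eq; unfold x; lra. }
    assert (F : x / (1 + b) < 2 / 3).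
    { apply (phi_Ne_real_values _ (w x)); [now apply Hw1|].
      rewrite <- Ew by exact Hx. unfold p. rewrite RtoC_div by lra. field. exact Hb1. }
    apply (Rlt_div_l x (2 / 3) (1 + b)) in F; [|lra]. unfold x in F. lra.
Qed.
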